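(* Let $R$ be a right Noetherian local ring. Then the following are equivalent. (1) $R$ is right almost-$QF$. (2) $R$ is right max-$QF$. (3) $R$ is $QF$ or right small.
   Context: Rings are associative with identity; modules are unital right modules. A right $R$-module $M$ is $R$-projective if for every right ideal $I$ of $R$, every homomorphism $M\to R/I$ factors through the canonical projection $R\to R/I$; it is max-projective if this holds for every maximal right ideal $I$. A ring $R$ is right almost-$QF$ (resp. right max-$QF$) if every injective right $R$-module is $R$-projective (resp. max-projective). A ring is $QF$ (quasi-Frobenius) if and only if every injective right module over it is projective. A submodule $K$ of $M$ is superfluous, written $K\ll M$, if $K+L\neq M$ for every proper submodule $L$ of $M$. $R$ is a right small ring if $R_R\ll E(R_R)$, where $E(R_R)$ is the injective hull of $R_R$. *)

(* Defs.v *)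
From HB Require Import structures.
From mathcomp Require Import all_boot all_algebra.
From mathcomp Require Import boolp.

Set Implicit Arguments.
Unset Strict Implicit.
Unset Printing Implicit Defensive.

Import GRing.Theory.
Local Open Scope ring_scope.
Local Open Scope quotient_scope.

(* A right R-module is an [lmodType R^c], where R^c is the opposite ring and
   [a *: m] stands for m.a: indeed [a *: (b *: m) = (a * b : R^c) *: m] reads
   (m.b).a = m.(ba).  Submodules are boolean predicates; in the classical
   setting of [boolp] (every proposition is reflected by a boolean, every type
   has a choiceType structure) this restricts neither the submodules nor the
   carriers of rings and modules. *)
Notation rmodType R := (lmodType R^c).

(* R_R: here [a *: x] is the product [x * a] of R. *)
Notation regular_rmod R := ((R^c)^o).

Notation right_ideal R := (submodClosed (regular_rmod R)).

Section QuotientModule.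
Variables (S : pzRingType) (V : lmodType S).

Fact submod_zmod_closed (U : submodClosed V) : zmod_closed U.
Proof.
by split=> [|x y xU yU]; rewrite ?rpred0 // rpredD // -scaleN1r rpredZ.
Qed.

Variable U : submodClosed V.

Let U_zmod : zmodClosed V := HB.pack (U : {pred V})
  (GRing.isZmodClosed.Build V (U : {pred V}) (submod_zmod_closed U)).

Definition quotient_module : Type := Quotient.quot U_zmod.

HB.instance Definition _ := GRing.Zmodule.on quotient_module.

Definition quotient_pi (x : V) : quotient_module :=
  \pi_(Quotient.quot U_zmod) x.

Definition quotient_scale (a : S) (x : quotient_module) : quotient_module :=
  quotient_pi (a *: repr (x : Quotient.quot U_zmod)).

Fact quotient_piE x y : quotient_pi x = quotient_pi y <-> x - y \in U.
Proof.
have E := Quotient.idealrBE U_zmod x y.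
by split=> [/eqP|xyU]; [rewrite -E | apply/eqP; rewrite -E].
Qed.

Fact quotient_pi_surj (x : quotient_module) : exists y, quotient_pi y = x.
Proof. by exists (repr (x : Quotient.quot U_zmod)); exact: reprK. Qed.

Fact quotient_pi_zmod : zmod_morphism quotient_pi.
Proof. exact: (@pi_is_zmod_morphism V _ _ (Quotient.quot U_zmod)). Qed.

HB.instance Definition _ := GRing.isZmodMorphism.Build V quotient_module
  quotient_pi quotient_pi_zmod.

Fact quotient_pi_scale a x : quotient_pi (a *: x) = quotient_scale a (quotient_pi x).
Proof.
apply/quotient_piE; rewrite -scalerBr rpredZ //; apply/quotient_piE.
by rewrite /quotient_pi reprK.
Qed.

Fact quotient_scaleA a b x :
  quotient_scale a (quotient_scale b x) = quotient_scale (a * b) x.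
Proof.
by have [y <-] := quotient_pi_surj x; rewrite -!quotient_pi_scale scalerA.
Qed.

Fact quotient_scale1 : left_id 1 quotient_scale.
Proof.
by move=> x; have [y <-] := quotient_pi_surj x; rewrite -quotient_pi_scale scale1r.
Qed.

Fact quotient_scaleDr : right_distributive quotient_scale +%R.
Proof.
move=> a x y; have [x' <-] := quotient_pi_surj x.
have [y' <-] := quotient_pi_surj y.
by rewrite -raddfD -!quotient_pi_scale -raddfD scalerDr.
Qed.

Fact quotient_scaleDl x : {morph quotient_scale^~ x : a b / a + b}.
Proof.
move=> a b; have [y <-] := quotient_pi_surj x.
by rewrite -!quotient_pi_scale -raddfD scalerDl.
Qed.

HB.instance Definition _ := GRing.Zmodule_isLmodule.Build S quotient_module
  quotient_scaleA quotient_scale1 quotient_scaleDr quotient_scaleDl.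

HB.instance Definition _ := GRing.isScalable.Build S V quotient_module *:%R
  quotient_pi quotient_pi_scale.

End QuotientModule.

Arguments quotient_pi {S V} U x.

Section Submodules.
Variables (S : pzRingType) (V : lmodType S).

Definition proper_submod (U : submodClosed V) := exists x, x \notin U.

Definition maximal_submod (U : submodClosed V) :=
  proper_submod U /\
  forall W : submodClosed V, {subset U <= W} -> W =i U \/ W =i predT.

Definition superfluous (K : submodClosed V) :=
  forall L : submodClosed V, proper_submod L ->
    ~ (forall x, exists k l, [/\ k \in K, l \in L & x = k + l]).

Definition essential (K : submodClosed V) :=
  forall L : submodClosed V, (exists2 x, x \in L & x != 0) ->
    exists x, [/\ x \in K, x \in L & x != 0].

End Submodules.

Section Image.
Variables (S : pzRingType) (V W : lmodType S) (f : {linear V -> W}).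

Definition image_submod : {pred W} := fun y => `[< exists x, f x = y >].

Fact image_submod_closed : submod_closed image_submod.
Proof.
split=> [|a _ _ /asboolP[x <-] /asboolP[y <-]]; apply/asboolP.
  by exists 0; rewrite raddf0.
by exists (a *: x + y); rewrite linearP.
Qed.

HB.instance Definition _ :=
  GRing.isSubmodClosed.Build S W image_submod image_submod_closed.

End Image.

Section InjectiveProjective.
Variables (S : pzRingType) (M : lmodType S).

Definition injective_module :=
  forall (A B : lmodType S) (i : {linear A -> B}) (f : {linear A -> M}),
    injective i -> exists g : {linear B -> M}, f =1 g \o i.

Definition projective_module :=
  forall (A B : lmodType S) (p : {linear A -> B}) (f : {linear M -> B}),
    (forall b, exists a, p a = b) -> exists g : {linear M -> A}, f =1 p \o g.

End InjectiveProjective.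

(* (E, e) is an injective hull of M, M being identified with its image. *)
Definition injective_hull (S : pzRingType) (M E : lmodType S)
    (e : {linear M -> E}) :=
  [/\ injective e, injective_module E & essential (image_submod e)].

Section Rings.
Variable R : nzRingType.

Definition lifts_mod (M : rmodType R) (I : right_ideal R) :=
  forall f : {linear M -> quotient_module I},
    exists g : {linear M -> regular_rmod R}, f =1 quotient_pi I \o g.

Definition R_projective (M : rmodType R) :=
  forall I : right_ideal R, lifts_mod M I.

Definition max_projective (M : rmodType R) :=
  forall I : right_ideal R, maximal_submod I -> lifts_mod M I.

Definition right_almost_QF :=
  forall M : rmodType R, injective_module M -> R_projective M.

Definition right_max_QF :=
  forall M : rmodType R, injective_module M -> max_projective M.

(* Quasi-Frobenius rings, described by their (right) module category. *)
Definition QF :=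
  forall M : rmodType R, injective_module M -> projective_module M.

(* Injective hulls being unique up to isomorphism over R_R, the choice of the
   hull is immaterial. *)
Definition right_small :=
  exists (E : rmodType R) (e : {linear regular_rmod R -> E}),
    injective_hull e /\ superfluous (image_submod e).

Definition right_noetherian :=
  forall I : nat -> right_ideal R,
    (forall n, {subset I n <= I n.+1}) ->
    exists n, forall m, (n <= m)%N -> I m =i I n.

(* There is exactly one maximal right ideal. *)
Definition local_ring :=
  exists2 J : right_ideal R, maximal_submod J &
    forall I : right_ideal R, maximal_submod I -> I =i J.

End Rings.

(* Main.v *)
Require Import Defs.
From HB Require Import structures.
From mathcomp Require Import all_boot all_algebra.
From mathcomp Require Import boolp classical_sets functions.

(** Everything is done with left modules over a ring [S]; the theorem is the
    case where [S] is the opposite ring of [R], so that one-sided notions below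
    read as right-handed notions of [R].

    Almost-QF implies max-QF by definition. The two other implications rest on
    the following arguments.

    If [S] is superfluous in its injective hull [E] and Noetherian, an injective
    module [M] has no nonzero map to a cyclic module, so that lifting is trivial
    ([superfluous_hom0]). Indeed the image of such a map is Noetherian, hence
    has a maximal submodule; sending 1 to an element of [M] outside its preimage
    and extending the map from [S] to [E] gives a proper submodule of [E] that
    is a supplement of [S]. If [S] is QF, injective modules are projective and
    lift along all surjections.

    Conversely, let [S] be max-QF and not superfluous in [E], say [E = S + L]
    with [L] proper. As [S] is local with maximal ideal [J], the map sending
    [s + l] to the class of [s] is a well-defined map from [E] to [S / J]
    ([not_superfluous_map]). It lifts to [g : E -> S], and [g 1] is not in [J],
    so it is invertible. Hence [S] is a retract of [E], and [S] is
    self-injective ([max_QF_small_or_selfinjective]).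

    A local Noetherian self-injective ring is QF
    ([local_selfinjective_projective]). Extending homomorphisms between ideals
    to right multiplications shows that nonzero left ideals meet
    ([selfinjective_uniform]) and that elements of [J] have nonzero left
    annihilators; with the chain condition this makes [J] nilpotent
    ([local_ideal_nilpotent]), so every nonzero module contains a nonzero
    element killed by [J] ([local_socle]). When it lies in an injective module,
    such an element is a multiple of an element that generates a free submodule
    ([free_generator]). By Zorn's lemma an injective module [M] is then
    exhausted by free summands. Rather than building a basis, the proof extends
    a lift of a map from [M] along a surjection one free generator at a time.
    The condition that makes a step possible at every stage is
    [extends_induced_maps]; it is a local form of injectivity, and the
    Noetherian hypothesis makes it stable under unions of chains.

    Showing that [S] is superfluous in a hull first requires a hull. The group
    of rationals modulo the integers is an injective cogenerator of abelian
    groups, coinduction turns it into injective [S]-modules, and [S] embeds in a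
    product of these ([enough_injectives_regular]). A maximal essential
    extension inside an injective module is a retract of it
    ([essential_closure_retract]). *)

Set Implicit Arguments.
Unset Strict Implicit.
Unset Printing Implicit Defensive.

Import GRing.Theory Num.Theory.
Local Open Scope ring_scope.
Local Open Scope classical_set_scope.

(** * Submodules as sets, and linear maps as graphs *)

Definition submod (S : pzRingType) (V : lmodType S) (U : set V) :=
  U 0 /\ forall a x y, U x -> U y -> U (a *: x + y).

Section SubmoduleSets.
Variables (S : pzRingType) (V : lmodType S).
Implicit Types U : set V.

Lemma submodD U x y : submod U -> U x -> U y -> U (x + y).
Proof. by move=> [_ h] Ux Uy; rewrite -[x]scale1r; exact: h. Qed.

Lemma submodZ U a x : submod U -> U x -> U (a *: x).
Proof. by move=> [U0 h] Ux; rewrite -[_ *: x]addr0; exact: h. Qed.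

Lemma submodN U x : submod U -> U x -> U (- x).
Proof. by move=> hU Ux; rewrite -scaleN1r; exact: submodZ. Qed.

Lemma submodB U x y : submod U -> U x -> U y -> U (x - y).
Proof. by move=> hU Ux Uy; apply: submodD => //; exact: submodN. Qed.

Lemma submod_mem (K : submodClosed V) : submod [set x | x \in K].
Proof.
by split=> [|a x y] /=; [exact: rpred0 | move=> ? ?; rewrite rpredD ?rpredZ].
Qed.

(** Sets are easier to combine (unions of chains, inverse images, Zorn's lemma);
    this returns from them to the bundled submodules. *)
Lemma bundle_submod U : submod U ->
  exists K : submodClosed V, forall x, (x \in K) = `[< U x >].
Proof.
move=> [U0 hU]; pose p : {pred V} := fun x => `[< U x >].
have pP : submod_closed p.
  by split=> [|a x y /asboolP Ux /asboolP Uy]; apply/asboolP => //; exact: hU.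
pose K : submodClosed V := HB.pack p (GRing.isSubmodClosed.Build S V p pP).
by exists K.
Qed.

(** Unions of chains are only required for nonempty chains, since the empty
    union is not a submodule; [U0] takes the place of that union. *)
Lemma Zorn_submod (P : set (set V)) U0 :
  (forall U, P U -> submod U) -> P U0 ->
  (forall F : set (set V), F `<=` P -> total_on F subset -> F !=set0 ->
    P (\bigcup_(X in F) X)) ->
  exists2 U, P U & forall W, P W -> U `<=` W -> W `<=` U.
Proof.
move=> Psub PU0 chainP; pose Q (U : set V) := U = set0 \/ P U.
have [F FQ totF|U [QU maxU]] := @Zorn_bigcup V Q.
  pose F' := [set X | F X /\ P X].
  have [[X F'X]|noF'] := pselect (F' !=set0); last first.
    left; rewrite -subset0 => x [X FX Xx].
    case: (FQ X FX) => [X0|PX]; first by rewrite X0 in Xx.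
    by case: noF'; exists X.
  right; suff -> : \bigcup_(X in F) X = \bigcup_(X in F') X.
    apply: chainP; [by move=> Y [] | | by exists X].
    by move=> Y Z [FY _] [FZ _]; exact: totF.
  apply/seteqP; split=> x [Y]; last by move=> [FY _] Yx; exists Y.
  move=> FY Yx; case: (FQ Y FY) => [Y0|PY]; first by rewrite Y0 in Yx.
  by exists Y.
have PU : P U.
  case: QU => // U_0; have [U00 _] := Psub _ PU0.
  exfalso; apply: (maxU U0); last by right.
  by rewrite U_0; split=> // /(_ _ U00).
exists U => // W PW UW; apply: contrapT => WU.
by apply: (maxU W); [split|right].
Qed.

End SubmoduleSets.

Lemma submod_preimage (S : pzRingType) (V W : lmodType S) (f : {linear V -> W})
  (U : set W) : submod U -> submod [set x | U (f x)].
Proof.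
by move=> [U0 hU]; split=> [|a x y] /=; rewrite ?raddf0 // linearP; exact: hU.
Qed.

(** Linear maps are built from submodules of the product throughout, since their
    values are often only known to exist. *)
Lemma linear_of_graph (S : pzRingType) (V W : lmodType S) (G : set (V * W)) :
  submod G -> (forall x, exists y, G (x, y)) -> (forall y, G (0, y) -> y = 0) ->
  exists g : {linear V -> W}, forall x, G (x, g x).
Proof.
move=> hG /choice[g Gg] G0.
have glin : linear g.
  move=> a x y; apply/eqP; rewrite -subr_eq0; apply/eqP/G0.
  have := submodB hG (Gg (a *: x + y)) (hG.2 a _ _ (Gg x) (Gg y)).
  by congr (G (_, _)); rewrite /= subrr.
pose g' : {linear V -> W} := HB.pack g (GRing.isLinear.Build S V W *:%R g glin).
by exists g'.
Qed.

Section SubmoduleType.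
Variables (S : pzRingType) (V : lmodType S) (K : submodClosed V).

Definition submod_type := {x : V | x \in K}.

HB.instance Definition _ := SubChoice.on submod_type.
HB.instance Definition _ := [SubChoice_isSubLmodule of submod_type by <:].

End SubmoduleType.

(** The graph of a linear map defined on a submodule of [V]: for a submodule of
    the product, being single-valued at 0 is being single-valued. *)
Definition functional_graph (S : pzRingType) (V W : lmodType S)
    (G : set (V * W)) :=
  submod G /\ forall y, G (0, y) -> y = 0.

(** The graph itself is the module to which injectivity is applied: it embeds in
    [V] by the first projection and maps to [M] by the second. *)
Lemma injective_extends (S : pzRingType) (V M : lmodType S) (G : set (V * M)) :
  injective_module M -> functional_graph G ->
  exists g : {linear V -> M}, forall x y, G (x, y) -> g x = y.
Proof.
move=> injM [hG G0]; have [K KE] := bundle_submod hG.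
pose i : {linear submod_type K -> V} := fst \o val.
pose f : {linear submod_type K -> M} := snd \o val.
have inj_i : injective i.
  apply: raddf_inj => -[[x y] /= xyK] /= x0; apply: val_inj => /=.
  move: x0 xyK; rewrite /i /= => ->; rewrite KE => /asboolP /G0 -> //.
have [g gE] := injM _ _ i f inj_i.
exists g => x y Gxy.
have xyK : (x, y) \in K by rewrite KE; apply/asboolP.
by have /= <- := gE (exist (fun z => z \in K) _ xyK).
Qed.

Lemma injective_of_extends (S : pzRingType) (M : lmodType S) :
  (forall (V : lmodType S) (G : set (V * M)), functional_graph G ->
    exists g : {linear V -> M}, forall x y, G (x, y) -> g x = y) ->
  injective_module M.
Proof.
move=> extM A B i f inj_i; pose G := [set (i a, f a) | a in [set: A]].
have [|g gE] := extM B G.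
  split; first split.
  - by exists 0; rewrite // !raddf0.
  - by move=> a _ _ [x _ <-] [y _ <-]; exists (a *: x + y); rewrite // !linearP.
  by move=> y [x _ [ix0 <-]]; rewrite (inj_i x 0) ?raddf0.
by exists g => a /=; rewrite (gE _ (f a)) //; exists a.
Qed.

Lemma linear_corestriction (S : pzRingType) (V W : lmodType S)
    (f : {linear V -> W}) (K : submodClosed W) :
  (forall x, f x \in K) ->
  exists g : {linear V -> submod_type K}, forall x, val (g x) = f x.
Proof.
move=> fK; pose g x : submod_type K := exist (fun y => y \in K) (f x) (fK x).
have g_lin : linear g by move=> a x y; apply: val_inj; rewrite /= linearP.
pose g' : {linear V -> submod_type K} :=
  HB.pack g (GRing.isLinear.Build S V (submod_type K) *:%R g g_lin).
by exists g'.
Qed.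

Lemma injective_retract (S : pzRingType) (M N : lmodType S)
    (e : {linear N -> M}) (r : {linear M -> N}) :
  injective_module M -> cancel e r -> injective_module N.
Proof.
move=> injM eK A B i f inj_i.
have [g gE] := injM A B i (e \o f : {linear _ -> _}) inj_i.
by exists (r \o g : {linear _ -> _}) => a; rewrite /= -[g (i a)]gE /= eK.
Qed.

(** * Baer's criterion *)

Lemma functional_graph_eq (S : pzRingType) (V W : lmodType S) (G : set (V * W))
  x y z : functional_graph G -> G (x, y) -> G (x, z) -> y = z.
Proof.
move=> [hG G0] Gy Gz; apply/eqP; rewrite -subr_eq0; apply/eqP/G0.
by rewrite -(subrr x); exact: (submodB hG Gy Gz).
Qed.

Lemma submod_chain (S : pzRingType) (V : lmodType S) (F : set (set V)) :
  (forall X, F X -> submod X) -> total_on F subset -> F !=set0 ->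
  submod (\bigcup_(X in F) X).
Proof.
move=> FP totF [X0 FX0]; split; first by exists X0 => //; exact: (FP _ FX0).1.
move=> a x y [X FX Xx] [Y FY Yy]; have [XY|YX] := totF X Y FX FY.
  by exists Y => //; apply: (FP _ FY).2 => //; exact: XY.
by exists X => //; apply: (FP _ FX).2 => //; exact: YX.
Qed.

Lemma functional_graph_chain (S : pzRingType) (V W : lmodType S)
    (F : set (set (V * W))) :
  F `<=` (@functional_graph S V W) -> total_on F subset -> F !=set0 ->
  functional_graph (\bigcup_(X in F) X).
Proof.
move=> FP totF F_n0; split; last by move=> y [X FX Xy]; exact: (FP _ FX).2.
by apply: submod_chain => // X /FP[].
Qed.

Lemma adjoin_submod (S : pzRingType) (V : lmodType S) (U : set V) v :
  submod U -> submod [set x | exists c, U (x - c *: v)].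
Proof.
move=> hU; split=> [|a x y [c Ux] [d Uy]] /=.
  by exists 0; rewrite scale0r subr0; exact: hU.1.
exists (a * c + d); rewrite scalerDl -scalerA opprD addrACA -scalerBr.
exact: hU.2.
Qed.

(** A maximal extension of the given graph is everywhere defined: for [v]
    outside its domain, the graph pulled back along [a |-> a *: v] is a partial
    map on the ring, hence of the form [a |-> a *: m], and [v |-> m] extends the
    graph. *)
Lemma Baer (S : pzRingType) (M : lmodType S) :
  (forall G : set (S^o * M), functional_graph G ->
    exists m, forall (a : S) y, G (a, y) -> y = a *: m) ->
  injective_module M.
Proof.
move=> baerM; apply: injective_of_extends => V G0 hG0.
pose P (G : set (V * M)) := functional_graph G /\ G0 `<=` G.
have [||F FP totF [X FX]|G [hG G0G] maxG] := @Zorn_submod _ _ P G0.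
- by move=> U [[]].
- by split.
- split; last by move=> x G0x; exists X => //; exact: (FP _ FX).2.
  by apply: functional_graph_chain; [move=> Y /FP[] | | exists X].
suff totG v : exists m, G (v, m).
  have [g Gg] := linear_of_graph hG.1 totG hG.2.
  by exists g => x y /G0G Gxy; exact: functional_graph_eq (Gg x) Gxy.
pose I : set (S^o * M) := [set z | G (z.1 *: v, z.2)].
have hI : functional_graph I.
  split; last by move=> y; rewrite /I /= scale0r; exact: hG.2.
  split=> [|a [x m] [y n]]; rewrite /I /= ?scale0r; first exact: hG.1.1.
  by rewrite scalerDl -scalerA => Gx Gy; exact: (hG.1.2 a _ _ Gx Gy).
have [m mE] := baerM _ hI.
pose G' : set (V * M) := [set x | exists c, G (x - c *: (v, m))].
have GG' : G `<=` G' by move=> x Gx; exists 0; rewrite scale0r subr0.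
have PG' : P G'.
  split; last exact: subset_trans GG'.
  split; first exact/adjoin_submod/hG.1.
  move=> y [c]; have -> : (0, y) - c *: (v, m) = (- c *: v, y - c *: m).
    by congr pair; rewrite /= ?sub0r ?scaleNr.
  by move=> /(mE (- c))/eqP; rewrite scaleNr subr_eq addNr => /eqP.
exists m; apply: (maxG G' PG' GG'); exists 1; rewrite scale1r subrr;
  exact: hG.1.1.
Qed.

Lemma injective_extends_regular (S : pzRingType) (M : lmodType S)
    (G : set (S^o * M)) :
  injective_module M -> functional_graph G ->
  exists m, forall (a : S) y, G (a, y) -> y = a *: m.
Proof.
move=> injM hG; have [g gE] := injective_extends injM hG.
exists (g (1 : S)) => a y /gE <-.
by rewrite -linearZ /= [_ *: _]mulr1.
Qed.

(** * Injective embeddings of the regular module *)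

(** The zero ideal corresponds to [n = 0], since 0 only divides 0. *)
Lemma int_ideal_principal (I : set int^o) :
  submod I -> exists n : nat, forall k : int, I k <-> (n%:Z %| k)%Z.
Proof.
move=> hI.
have [[m [m_gt0 Im]]|noI] := pselect (exists m : nat, (0 < m)%N /\ I m%:Z).
  have exP : exists m : nat, (0 < m)%N && `[< I m%:Z >].
    by exists m; rewrite m_gt0; apply/asboolP.
  case: (ex_minnP exP) => n /andP[n_gt0 /asboolP In] n_min.
  exists n => k; split=> [Ik|/dvdzP[q ->]]; last exact: (submodZ q hI In).
  have Ir : I (k %% n)%Z.
    exact: (submodB hI Ik (submodZ _ hI In)).
  have r_ge0 : 0 <= (k %% n)%Z by rewrite modz_ge0 // -lt0n.
  have r_ltn : (k %% n)%Z < n%:Z by rewrite ltz_mod // -lt0n.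
  apply/dvdz_mod0P; move: Ir r_ge0 r_ltn; case: (k %% n)%Z => // r Ir _ r_ltn.
  case: (posnP r) => [->//|r_gt0].
  have := n_min r; rewrite r_gt0 leqNgt -ltz_nat r_ltn.
  by move/(_ (asboolT Ir)).
exists 0%N => k; rewrite dvd0z; split=> [Ik|/eqP->]; last exact: hI.1.
apply/negPn/negP => k_n0; apply: noI; exists `|k|%N.
split; first by rewrite absz_gt0.
rewrite abszE; have [_|_] := ger0P k => //; exact: (submodN hI Ik).
Qed.

Lemma injective_divisible (T : lmodType int) :
  (forall (n : nat) (t : T), (0 < n)%N -> exists u, t = n%:Z *: u) ->
  injective_module T.
Proof.
move=> divT; apply: Baer => G hG.
pose I : set int^o := [set k | exists y, G (k, y)].
have [|n nP] := @int_ideal_principal I.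
  split; first by exists 0; exact: hG.1.1.
  move=> a x y [u Gu] [v Gv]; exists (a *: u + v).
  exact: (hG.1.2 a _ _ Gu Gv).
have [y Gy] : I n%:Z by apply/nP.
have [m mE] : exists m, y = n%:Z *: m.
  case: (posnP n) Gy => [-> /hG.2->|n_gt0 _]; last exact: divT.
  by exists 0; rewrite scaler0.
exists m => k z Gz; have /nP/dvdzP[q kE] : I k by exists z.
apply: (functional_graph_eq hG Gz); have := submodZ q hG.1 Gy.
by congr (G (_, _)); rewrite ?kE /= ?mE ?scalerA.
Qed.

(** The group is that of the rationals modulo the integers. It is divisible; it
    separates elements because it has a nonzero element killed by [m] for every
    [m > 1], so that a nonzero cyclic group has a nonzero map to it. *)
Lemma injective_cogenerator_int :
  exists2 T : lmodType int, injective_module T &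
    forall (A : lmodType int) (x : A), x != 0 ->
      exists h : {linear A -> T}, h x != 0.
Proof.
pose Q : lmodType int := zmodule rat.
pose integers : set Q := [set x : rat | exists k : int, x = k%:~R].
have [|Z ZE] := @bundle_submod _ Q integers.
  split; first by exists 0.
  move=> a _ _ [k ->] [l ->]; exists (a * k + l); rewrite intrD mulrC intrM.
  by rewrite mulrzr.
pose T : lmodType int := quotient_module Z.
pose p (q : rat) : T := quotient_pi Z q.
have pZ n q : p (q *~ n) = n *: p q by exact: (quotient_pi_scale Z n (q : Q)).
have divT (n : nat) (t : T) : (0 < n)%N -> exists u, t = n%:Z *: u.
  move=> n_gt0; have [q <-] := quotient_pi_surj t.
  exists (p (q / n%:R)); rewrite -pZ -mulrzr divfK //.
  by rewrite pnatr_eq0 -lt0n.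
have injT := injective_divisible divT; exists T => // A x x_n0.
have [|n nP] := @int_ideal_principal [set k : int | k *: x = 0].
  split; rewrite /= ?scale0r // => a k l; rewrite scalerDl -scalerA => -> ->.
  by rewrite scaler0 addr0.
(* [n] is the order of [x], or 0 when the order is infinite; in that case any
   [m > 1] gives a well-defined map. *)
have [m m_gt1 m_n] : exists2 m : nat, (1 < m)%N & (m %| n)%N.
  case: n nP => [|[|n]] nP; [by exists 2%N | | by exists n.+2].
  have /nP : (1%:Z %| 1)%Z by [].
  by rewrite /= scale1r => x0; rewrite x0 eqxx in x_n0.
pose t := p (m%:R^-1).
have m_neq0 : m%:R != 0 :> rat by rewrite pnatr_eq0 -lt0n ltnW.
have t_n0 : t != 0.
  apply/eqP; rewrite /t /p -(raddf0 (quotient_pi Z)) quotient_piE subr0 ZE.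
  move=> /asboolP[k kE]; have : m%:Z * k = 1.
    by apply: (@intr_inj rat); rewrite intrM -kE mulfV.
  move=> mk1; have : (m%:Z %| 1)%Z by apply/dvdzP; exists k; rewrite mulrC mk1.
  by rewrite dvdz1 /= => /eqP m1; rewrite m1 in m_gt1.
have mt : m%:Z *: t = 0.
  rewrite /t -pZ -mulrzr mulVf // /p; apply/eqP.
  rewrite -(raddf0 (quotient_pi Z)); apply/eqP/quotient_piE.
  by rewrite subr0 ZE; apply/asboolP; exists 1.
pose G : set (A * T) := [set z | exists k : int, z = (k *: x, k *: t)].
have [|h hE] := injective_extends (G := G) injT.
  split; first split.
  - by exists 0; rewrite !scale0r.
  - move=> a _ _ [k ->] [l ->]; exists (a * k + l).
    by rewrite !scalerDl -!scalerA.
  move=> y [k [/esym/nP k0 ->]].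
  have /dvdzP[q ->] : (m%:Z %| k)%Z by apply: dvdz_trans k0.
  by rewrite -scalerA mt scaler0.
by exists h; rewrite (hE x t) //; exists 1; rewrite !scale1r.
Qed.

Section CoinducedModule.
Variables (S : pzRingType) (T : zmodType).

Definition additive_pred : {pred S -> T} := fun phi => `[< zmod_morphism phi >].

Fact additive_pred_zmod_closed : zmod_closed additive_pred.
Proof.
split=> [|f g /asboolP fD /asboolP gD]; apply/asboolP => x y.
  by rewrite [RHS]subr0.
by rewrite (_ : f - g = fun z => f z - g z) // fD gD !opprD addrACA.
Qed.

HB.instance Definition _ :=
  GRing.isZmodClosed.Build (S -> T) additive_pred additive_pred_zmod_closed.

(** The additive maps from [S] to [T], on which [S] acts by right translation of
    the argument; this is the right adjoint of restriction of scalars. *)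
Definition coinduced := {phi : S -> T | phi \in additive_pred}.

HB.instance Definition _ := SubChoice.on coinduced.
HB.instance Definition _ := [SubChoice_isSubZmodule of coinduced by <:].

Lemma coinducedB (phi : coinduced) x y :
  val phi (x - y) = val phi x - val phi y.
Proof. by case: phi => phi /= /asboolP. Qed.

Fact coinduced_scale_subproof a (phi : coinduced) :
  (fun x => val phi (x * a)) \in additive_pred.
Proof. by apply/asboolP => x y; rewrite mulrBl coinducedB. Qed.

Definition coinduced_scale a phi : coinduced :=
  exist (fun f => f \in additive_pred) _ (coinduced_scale_subproof a phi).

Fact coinduced_scaleA a b phi :
  coinduced_scale a (coinduced_scale b phi) = coinduced_scale (a * b) phi.
Proof. by apply: val_inj; apply/funext => x; rewrite /= mulrA. Qed.

Fact coinduced_scale1 : left_id 1 coinduced_scale.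
Proof. by move=> phi; apply: val_inj; apply/funext => x; rewrite /= mulr1. Qed.

Fact coinduced_scaleDr : right_distributive coinduced_scale +%R.
Proof. by move=> a phi psi; apply: val_inj; apply/funext => x. Qed.

Lemma coinduced0 (phi : coinduced) : val phi 0 = 0.
Proof. by have := coinducedB phi 0 0; rewrite !subrr. Qed.

Lemma coinducedD (phi : coinduced) x y :
  val phi (x + y) = val phi x + val phi y.
Proof.
have := coinducedB phi x (0 - y); rewrite [val phi (0 - y)]coinducedB.
by rewrite coinduced0 !sub0r !opprK.
Qed.

Fact coinduced_scaleDl phi : {morph coinduced_scale^~ phi : a b / a + b}.
Proof.
by move=> a b; apply: val_inj; apply/funext => x; rewrite /= mulrDr coinducedD.
Qed.

HB.instance Definition _ := GRing.Zmodule_isLmodule.Build S coinduced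
  coinduced_scaleA coinduced_scale1 coinduced_scaleDr coinduced_scaleDl.

Lemma coinducedZ a (phi : coinduced) x : val (a *: phi) x = val phi (x * a).
Proof. by []. Qed.

End CoinducedModule.

Lemma coinduced_mulrz (S : pzRingType) (T : zmodType)
    (phi : coinduced S T) x n :
  val phi (x *~ n) = val phi x *~ n.
Proof.
pose f : {additive S -> T} :=
  HB.pack (val phi) (GRing.isZmodMorphism.Build S T (val phi) (coinducedB phi)).
exact: (raddfMz f).
Qed.

(** By adjunction: a partial map to the coinduced module, evaluated at 1, is a
    partial additive map [h] to [T]; once [h] is extended, the linear extension
    is [b |-> (y |-> h (y *: b))]. *)
Lemma injective_coinduced (S : pzRingType) (T : lmodType int) :
  injective_module T -> injective_module (coinduced S T : lmodType S).
Proof.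
move=> injT; apply: injective_of_extends => V G hG.
pose GT : set (zmodule V * T) :=
  [set z | exists phi, G (z.1, phi) /\ z.2 = val phi 1].
have [|h hE] := injective_extends (G := GT) injT.
  split; last by move=> y [phi [/hG.2 -> /= ->]].
  split; first by exists 0; split=> //; exact: hG.1.1.
  move=> a [x _] [y _] [phi [/= Gx ->]] [psi [/= Gy ->]].
  exists (a%:~R *: phi + psi); split.
    have := hG.1.2 a%:~R _ _ Gx Gy; congr (G (_, _)) => /=.
    by rewrite scalezrE scaler_int.
  rewrite [RHS]/(val (a%:~R *: phi) 1 + val psi 1) coinducedZ mul1r.
  by rewrite coinduced_mulrz /= -scaler_int intz.
have h_add (b : V) : (fun y : S => h (y *: b)) \in @additive_pred S T.
  by apply/asboolP => x y; rewrite scalerBl (raddfB h).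
pose g (b : V) : coinduced S T :=
  exist (fun f => f \in @additive_pred S T) _ (h_add b).
have g_lin : linear g.
  move=> a x y; apply: val_inj; apply/funext => s.
  rewrite [RHS]/(h ((s * a) *: x) + h (s *: y)) /=.
  by rewrite scalerDr scalerA (raddfD h).
pose g' : {linear V -> coinduced S T} :=
  HB.pack g (GRing.isLinear.Build S V (coinduced S T) *:%R g g_lin).
exists g' => x phi Gx; apply: val_inj; apply/funext => s /=.
apply: hE; exists (s *: phi); split; first exact: (submodZ s hG.1 Gx).
by rewrite coinducedZ mul1r.
Qed.

Lemma injective_product (S : pzRingType) (X : Type) (M : lmodType S) :
  injective_module M -> injective_module (X -> M).
Proof.
move=> injM A B i f inj_i.
have /choice[g gE] (x : X) :
    exists g : {linear B -> M}, forall a, f a x = g (i a).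
  have fx_lin : linear (fun a => f a x) by move=> a u v; rewrite linearP.
  pose fx : {linear A -> M} := HB.pack (fun a => f a x)
    (GRing.isLinear.Build S A M *:%R _ fx_lin).
  by have [g gE] := injM _ _ i fx inj_i; exists g => a; exact: gE.
have h_lin : linear (fun b x => g x b).
  by move=> a u v; apply/funext => x; rewrite linearP.
pose h : {linear B -> X -> M} := HB.pack (fun b x => g x b)
  (GRing.isLinear.Build S B (X -> M) *:%R _ h_lin).
by exists h => a; apply/funext => x; rewrite gE.
Qed.

(** The product is indexed by the elements of [S], the factor of index [x]
    having to detect [x]: for this it uses an additive map [t x] with
    [t x x != 0]. *)
Lemma enough_injectives_regular (S : pzRingType) :
  exists2 E : lmodType S, injective_module E &
    exists e : {linear S^o -> E}, injective e.
Proof.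
have [T injT cogT] := injective_cogenerator_int.
exists (S -> coinduced S T); first exact/injective_product/injective_coinduced.
have /choice[t tE] (s : S) :
    exists t : {linear zmodule S -> T}, s != 0 -> t s != 0.
  have [->|s_n0] := eqVneq s 0; first by exists \0.
  by have [t ts] := cogT (zmodule S) s s_n0; exists t.
have e_add (s x : S) : (fun y : S => t x (y * s)) \in @additive_pred S T.
  by apply/asboolP => y z; rewrite mulrBl (raddfB (t x)).
pose e (s : S^o) (x : S) : coinduced S T :=
  exist (fun f => f \in @additive_pred S T) _ (e_add s x).
have e_lin : linear e.
  move=> a u v; apply/funext => x; apply: val_inj; apply/funext => y.
  rewrite [RHS]/(t x (y * a * u) + t x (y * v)) /=.
  by rewrite -[a *: u]/(a * u) mulrDr mulrA (raddfD (t x)).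
pose e' : {linear S^o -> S -> coinduced S T} := HB.pack e
  (GRing.isLinear.Build S S^o (S -> coinduced S T) *:%R e e_lin).
exists e'; apply: raddf_inj => s es0; have ts0 : t s (1 * s) = 0.
  by have := congr1 (fun f : S -> coinduced S T => val (f s) 1) es0.
by rewrite mul1r in ts0; apply/eqP/negPn/negP => /tE; rewrite ts0 eqxx.
Qed.

(** * Injective hulls *)

(** Essentiality tested on cyclic submodules, a form that passes to unions of
    chains. *)
Definition essential_over (S : pzRingType) (V : lmodType S) (A U : set V) :=
  forall x, U x -> x != 0 -> exists c, A (c *: x) /\ c *: x != 0.

(** [U] is a maximal essential extension of [A], [C] is maximal among the
    submodules that meet [A] trivially, and [u] extends the projection from
    [U + C] to [U]. The image of [u] is essential over [A] by maximality of [C],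
    so it is [U] by maximality of [U]. *)
Lemma essential_closure_retract (S : pzRingType) (E : lmodType S) (A : set E) :
  injective_module E -> submod A ->
  exists (U : set E) (u : {linear E -> E}),
    [/\ submod U, A `<=` U, essential_over A U, (forall x, U x -> u x = x)
      & forall x, U (u x)].
Proof.
move=> injE hA.
pose P U := [/\ submod U, A `<=` U & essential_over A U].
have [||F FP totF [X0 FX0]|U PU maxU] := @Zorn_submod _ _ P A.
- by move=> U [].
- by split=> // x Ax x_n0; exists 1; rewrite scale1r.
- split; first by apply: submod_chain => //; [move=> X /FP[] | exists X0].
    by move=> x Ax; exists X0 => //; have [_ AX _] := FP _ FX0; exact: AX.
  by move=> x [X FX Xx] x_n0; have [_ _ essX] := FP _ FX; exact: essX.
pose Q (C : set E) := submod C /\ forall x, C x -> A x -> x = 0.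
have [||F FQ totF [X0 FX0]|C [hC CA0] maxC] := @Zorn_submod _ _ Q [set 0].
- by move=> C [].
- by split=> [|x -> //]; split=> // a x y -> ->; rewrite scaler0 addr0.
- split; first by apply: submod_chain => //; [move=> X /FQ[] | exists X0].
  by move=> x [X FX Xx]; exact: (FQ _ FX).2.
have [hU AU essU] := PU.
have UC0 x : U x -> C x -> x = 0.
  move=> Ux Cx; apply: contrapT => /eqP x_n0.
  have [c [Acx /eqP[]]] := essU x Ux x_n0; apply: CA0 => //; exact: submodZ.
pose G : set (E * E) := [set z | U z.2 /\ C (z.1 - z.2)].
have [|u uE] := injective_extends (G := G) injE.
  split; last first.
    move=> y [/= Uy]; rewrite sub0r => /(submodN hC); rewrite opprK; exact: UC0.
  split=> [|a x y [/= Ux Cx] [/= Uy Cy]]; rewrite /G /=.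
    by rewrite subr0; split; [exact: hU.1 | exact: hC.1].
  split; first exact: hU.2.
  by rewrite opprD addrACA -scalerBr; exact: hC.2.
have uU x : U x -> u x = x.
  by move=> Ux; apply: uE; split=> //=; rewrite subrr; exact: hC.1.
have uC x : C x -> u x = 0.
  by move=> Cx; apply: uE; split=> /=; [exact: hU.1 | rewrite subr0].
exists U, u; split=> // x; pose W : set E := range u.
suff PW : P W.
  by apply: (maxU W PW) => [y Uy|]; [exists y => //; exact: uU | exists x].
split; first split.
- by exists 0; rewrite // raddf0.
- by move=> a _ _ [y _ <-] [z _ <-]; exists (a *: y + z); rewrite // linearP.
- by move=> y /AU Uy; exists y; rewrite // uU.
move=> _ [y _ <-] uy_n0; pose C' : set E := [set z | exists c, C (z - c *: y)].
have Cn_y : ~ C y by move=> /uC uy0; rewrite uy0 eqxx in uy_n0.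
have [z [[c Czcy] Az z_n0]] : exists z, [/\ C' z, A z & z <> 0].
  apply: contrapT => noz; apply: Cn_y; apply: (maxC C'); last 2 first.
  - by move=> z Cz; exists 0; rewrite scale0r subr0.
  - by exists 1; rewrite scale1r subrr; exact: hC.1.
  split; first exact: adjoin_submod.
  by move=> z C'z Az; apply: contrapT => z_n0; apply: noz; exists z.
have zE : z = c *: u y.
  have := uC _ Czcy; rewrite linearB linearZ (uU z (AU _ Az)) => /eqP.
  by rewrite subr_eq0 => /eqP.
by exists c; rewrite -zE; split=> //; apply/eqP.
Qed.

Lemma injective_hull_exists (S : pzRingType) (M E0 : lmodType S)
    (e0 : {linear M -> E0}) :
  injective_module E0 -> injective e0 ->
  exists (E : lmodType S) (e : {linear M -> E}), injective_hull e.
Proof.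
move=> injE0 inj_e0; pose A : set E0 := range e0.
have hA : submod A.
  split=> [|a _ _ [x _ <-] [y _ <-]]; first by exists 0; rewrite // raddf0.
  by exists (a *: x + y); rewrite // linearP.
have [U [u [hU AU essU uU Uu]]] := essential_closure_retract injE0 hA.
have [K KE] := bundle_submod hU.
have [|e eE] := @linear_corestriction _ _ _ e0 K.
  by move=> x; rewrite KE; apply/asboolP/AU; exists x.
have [|r rE] := @linear_corestriction _ _ _ u K.
  by move=> x; rewrite KE; exact/asboolP.
have valU (x : submod_type K) : U (val x).
  by apply/asboolP; rewrite -KE; exact: (valP x).
exists (submod_type K), e; split.
- by move=> x y /(congr1 val); rewrite !eE; exact: inj_e0.
- pose i : {linear submod_type K -> E0} := val.
  apply: (injective_retract (e := i) (r := r) injE0).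
  by move=> x; apply: val_inj; rewrite rE uU //; exact: valU.
move=> L [x Lx x_n0]; have [|c [[m _ em] cx_n0]] := essU _ (valU x).
  by apply: contra x_n0 => /eqP vx0; apply/eqP/val_inj.
exists (c *: x); split; last 2 first.
- by rewrite rpredZ.
- by apply: contra cx_n0 => /eqP/(congr1 val)/= ->.
by apply/asboolP; exists m; apply: val_inj; rewrite eE em.
Qed.

(** * Noetherian rings in which the ring is superfluous in its hull *)

(** The maximum condition, which is how the chain condition is used. *)
Definition noetherian_mod (S : pzRingType) (V : lmodType S) :=
  forall P : set (set V), (forall U, P U -> submod U) -> P !=set0 ->
  exists2 U, P U & forall W, P W -> U `<=` W -> W `<=` U.

Lemma noetherian_max (R : nzRingType) :
  right_noetherian R -> noetherian_mod (regular_rmod R).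
Proof.
move=> noethR P Psub [U0 PU0]; apply: contrapT => nomax.
have next U : exists W, P U -> P W /\ U `<` W.
  have [PU|nPU] := pselect (P U); last by exists U.
  apply: contrapT => noW; apply: nomax; exists U => // W PW UW.
  by apply: contrapT => nWU; apply: noW; exists W.
have [f fE] := choice next; pose I n := iter n f U0.
have PI n : P (I n) by elim: n => //= n /fE[].
have [J JE] := choice (fun n => bundle_submod (Psub _ (PI n))).
have [|n nE] := noethR J.
  move=> n x; rewrite !JE => /asboolP Ix; apply/asboolP.
  by have [_ [IS _]] := fE _ (PI n); exact: IS.
have [_ [_ []]] := fE _ (PI n); move=> x Ix.
have := nE n.+1 (leqnSn n) x; rewrite !JE (asboolT (Ix : I n.+1 x)).
by move/esym/asboolP.
Qed.

(** Let [K / I] be the image of [f], [N] a maximal proper submodule of [K]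
    containing [I], and [k] in [K] outside [N], the image of some [m0]. The map
    [r |-> r *: m0] extends to [h] on [E], and the inverse image of [N / I]
    under [f \o h] is a proper submodule whose sum with the image of [e] is
    [E]. *)
Lemma superfluous_hom0 (S : pzRingType) (E M : lmodType S)
    (e : {linear S^o -> E}) (I : submodClosed S^o)
    (f : {linear M -> quotient_module I}) :
  noetherian_mod S^o -> injective e -> superfluous (image_submod e) ->
  injective_module M -> forall m, f m = 0.
Proof.
move=> noethS inj_e small_e injM m; apply: contrapT => fm_n0.
pose K : set S^o := [set r | exists m, f m = quotient_pi I r].
have hK : submod K.
  split=> [|a r s [x fx] [y fy]]; first by exists 0; rewrite !raddf0.
  by exists (a *: x + y); rewrite !linearP fx fy.
pose P (N : set S^o) :=
  [/\ submod N, [set r | r \in I] `<=` N, N `<=` K & exists2 k, K k & ~ N k].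
have [||N [hN IN NK [k [m0 m0E] Nk]] maxN] := noethS P; first by move=> N [].
  exists [set r | r \in I]; split=> //; first exact: submod_mem.
    move=> r /= rI; exists 0; rewrite raddf0 -(raddf0 (quotient_pi I)).
    by apply/quotient_piE; rewrite sub0r; exact: (submodN (submod_mem I) rI).
  have [r rE] := quotient_pi_surj (f m); exists r; first by exists m.
  move=> /= rI; apply: fm_n0; rewrite -rE -(raddf0 (quotient_pi I)).
  by apply/quotient_piE; rewrite subr0.
pose G : set (E * M) := [set z | exists r : S, z = (e r, r *: m0)].
have [|h hE] := injective_extends (G := G) injM.
  split; last first.
    move=> y [r [er ->]]; rewrite (_ : r = 0) ?scale0r //.
    by apply: (inj_e r 0); rewrite raddf0.
  split=> [|a _ _ [r ->] [s ->]].
    by exists 0; rewrite scale0r (raddf0 e).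
  exists (a * r + s); congr pair; first by rewrite [RHS](linearP e).
  by rewrite /= scalerDl scalerA.
have he r : h (e r) = r *: m0 by apply: hE; exists r.
have hpiN : submod [set y | exists2 n, N n & y = quotient_pi I n].
  split=> [|a _ _ [n Nn ->] [n' Nn' ->]].
    by exists 0; [exact: hN.1 | rewrite raddf0].
  by exists (a *: n + n'); [exact: hN.2 | rewrite linearP].
have [L LE] := bundle_submod (submod_preimage (f \o h : {linear _ -> _}) hpiN).
apply: (small_e L).
  exists (e (1 : S)); rewrite LE; apply/asboolP => -[n Nn] /=.
  rewrite he scale1r m0E => /quotient_piE/IN Nkn; apply: Nk.
  by rewrite -[k](subrK n); exact: submodD.
move=> x; have [k' k'E] := quotient_pi_surj (f (h x)).
pose N' : set S^o := [set z | exists c : S, N (z - c *: k)].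
have NN' : N `<=` N' by move=> z Nz; exists 0; rewrite scale0r subr0.
have [c Nc] : N' k'.
  apply: contrapT => N'k'; apply: Nk; apply: (maxN N') => //; last first.
    by exists 1; rewrite scale1r subrr; exact: hN.1.
  split; [exact: adjoin_submod | exact: subset_trans NN' | |].
    move=> z [c /NK Kz]; rewrite -[z](subrK (c *: k)).
    by apply: submodD => //; apply: submodZ => //; exists m0.
  by exists k' => //; exists (h x).
exists (e c), (x - e c); split.
- by apply/asboolP; exists c.
- rewrite LE; apply/asboolP; exists (k' - c *: k) => //=.
  by rewrite !linearB linearZ /= -k'E -m0E he linearZ.
- by rewrite addrC subrK.
Qed.

(** * Local Noetherian self-injective rings *)

(** The maximal left ideal of a local ring. Left inverses are what maximality of
    [J] gives at once; that they are two-sided is deduced from this below. *)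
Definition local_ideal (S : nzRingType) (J : set S^o) :=
  [/\ submod J, ~ J (1 : S) & forall x : S, ~ J x -> exists y, y * x = 1].

(** The left ideal generated by [x] is proper if [x] has no left inverse, so it
    is contained in a maximal one, that is in [J]. *)
Lemma local_ideal_max (S : nzRingType) (J : submodClosed S^o) :
  noetherian_mod S^o -> maximal_submod J ->
  (forall I : submodClosed S^o, maximal_submod I -> I =i J) ->
  local_ideal [set x | x \in J].
Proof.
move=> noethS [[x0 x0J] maxJ] uniqJ; split; first exact: submod_mem.
  by move=> /= J1; rewrite -[x0]mulr1 [_ \in J](rpredZ x0 J1) in x0J.
move=> x /= /negP xJ; pose Sx : set S^o := [set r | exists y : S, r = y * x].
apply: contrapT => no_inv.
pose P U := [/\ submod U, Sx `<=` U & ~ U (1 : S)].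
have [||U [hU SxU U1] maxU] := noethS P; first by move=> U [].
  exists Sx; split=> //; last by move=> [y yx]; apply: no_inv; exists y.
  split; first by exists 0; rewrite mul0r.
  by move=> a _ _ [r ->] [s ->]; exists (a * r + s); rewrite mulrDl -mulrA.
have [K KE] := bundle_submod hU.
have maxK : maximal_submod K.
  split; first by exists (1 : S); rewrite KE; apply/asboolP.
  move=> W KW; have [W1|W1] := boolP ((1 : S) \in (W : {pred S^o})).
    by right=> y; rewrite -[y]mulr1 [LHS](rpredZ y W1).
  have UW : U `<=` [set y | y \in W].
    by move=> y Uy /=; apply: KW; rewrite KE; exact/asboolP.
  left=> y; apply/idP/idP; last exact: KW.
  rewrite KE => Wy; apply/asboolP; apply: (maxU _ _ UW y Wy); split.
  - exact: submod_mem.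
  - exact: subset_trans UW.
  - exact/negP.
move/negP: xJ; apply; rewrite -(uniqJ K maxK) KE; apply/asboolP/SxU.
by exists 1; rewrite mul1r.
Qed.

Section LocalRing.
Variables (S : nzRingType) (J : set S^o).
Hypothesis locJ : local_ideal J.

Let hJ : submod J. Proof. by case: locJ. Qed.

(** [a * u] is in [J], so [1 - a * u] is left invertible, while it kills [a] on
    the left as soon as [u * a = 1]. *)
Lemma local_ideal_mul_neq1 (u a : S) : J u -> u * a <> 1.
Proof.
have [_ J1 invJ] := locJ; move=> Ju ua1.
have [|z z1] := invJ (1 - a * u).
  move=> J1au; apply: J1; rewrite -[1](subrK (a * u)).
  exact: (submodD hJ J1au (submodZ a hJ Ju)).
have a0 : a = 0.
  by rewrite -[a]mul1r -z1 -mulrA mulrBl mul1r -mulrA ua1 mulr1 subrr mulr0.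
by move/eqP: ua1; rewrite a0 mulr0 eq_sym oner_eq0.
Qed.

Lemma local_ideal_right_inv (x : S) : ~ J x -> exists y, x * y = 1.
Proof.
have [_ _ invJ] := locJ; move=> /invJ[y yx1].
have [|y' y'y1] := invJ y; first by move=> Jy; exact: local_ideal_mul_neq1 yx1.
by exists y; rewrite -[x]mul1r -y'y1 -!mulrA (mulrA y) yx1 mul1r.
Qed.

Hypothesis selfinj : injective_module S^o.

(** Otherwise the projection from [S k + S k'] to its first summand is the right
    multiplication by some [t], so [k (1 - t) = 0] and [k' t = 0]; but [t] or
    [1 - t] is invertible. *)
Lemma selfinjective_uniform (k k' : S) : k != 0 -> k' != 0 ->
  exists a b, a * k = b * k' /\ a * k != 0.
Proof.
move=> k_n0 k'_n0; apply: contrapT => noab.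
pose G : set (S^o * S^o) :=
  [set z | exists a b : S, z = (a * k + b * k', a * k)].
have [|t tE] := @injective_extends_regular _ _ G selfinj.
  split; last first.
    move=> _ [a [b [/eqP + ->]]]; rewrite eq_sym addr_eq0 => /eqP ak.
    apply: contrapT => /eqP ak_n0; apply: noab; exists a, (- b); split=> //.
    by rewrite mulNr.
  split=> [|c _ _ [a [b ->]] [a' [b' ->]]].
    by exists 0, 0; rewrite !mul0r addr0.
  exists (c * a + a'), (c * b + b'); rewrite !mulrDl -!mulrA.
  by congr pair; rewrite /= [_ *: _]mulrDr addrACA.
have kt : k = k * t.
  by apply: tE; exists 1, 0; rewrite mul0r addr0 mul1r.
have k't : 0 = k' * t.
  by apply: tE; exists 0, 1; rewrite !mul0r add0r mul1r.
have [Jt|/local_ideal_right_inv[y ty]] := pselect (J t); last first.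
  by move/eqP: k'_n0; apply; rewrite -[k']mulr1 -ty mulrA -k't mul0r.
have [|y ty] := @local_ideal_right_inv (1 - t).
  have [_ J1 _] := locJ; move=> J1t; apply: J1; rewrite -[1](subrK t).
  exact: (submodD hJ J1t Jt).
move/eqP: k_n0; apply; rewrite -[k]mulr1 -ty mulrA mulrBr mulr1 -kt.
by rewrite subrr mul0r.
Qed.

(** Otherwise [a r |-> a] is a map, given by a right multiplication, and [r] has
    a right inverse. *)
Lemma local_ideal_singular (r : S) : J r -> exists2 b : S, b != 0 & b * r = 0.
Proof.
move=> Jr; apply: contrapT => nob.
pose G : set (S^o * S^o) := [set z | exists a : S, z = (a * r, a)].
have [|t tE] := @injective_extends_regular _ _ G selfinj.
  split; last first.
    move=> _ [a [/esym ar ->]]; apply: contrapT => /eqP a_n0.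
    by apply: nob; exists a.
  split=> [|c _ _ [a ->] [b ->]]; first by exists 0; rewrite mul0r.
  by exists (c * a + b); rewrite mulrDl -mulrA.
apply: (local_ideal_mul_neq1 (a := t) Jr).
by apply/esym/tE; exists 1; rewrite mul1r.
Qed.

Lemma local_ideal_annihilate (r a : S) : J r -> a != 0 ->
  exists2 x, x * a != 0 & x * a * r = 0.
Proof.
move=> Jr a_n0; have [b b_n0 br0] := local_ideal_singular Jr.
have [x [y [xa xa_n0]]] := selfinjective_uniform a_n0 b_n0.
by exists x => //; rewrite xa -mulrA br0 mulr0.
Qed.

Hypothesis noethS : noetherian_mod S^o.

(** The left annihilators [A n] of the products of [n] elements of [J] are
    stationary from some [n] on. If [A n] is not the whole ring, take [b]
    outside it with a maximal annihilator. For [j] in [J] the annihilator of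
    [b j] is strictly larger, so [b j] is in [A n]; hence [b] is in [A n.+1],
    which is [A n]. *)
Lemma local_ideal_nilpotent : exists n, forall js : seq S,
  size js = n -> (forall j, j \in js -> J j) -> \prod_(j <- js) j = 0.
Proof.
pose A n : set S^o := [set x | forall js : seq S, size js = n ->
  (forall j, j \in js -> J j) -> x * \prod_(j <- js) j = 0].
have hA n : submod (A n).
  split=> [|a x y Ax Ay] js js_n jsJ; first by rewrite mul0r.
  by rewrite mulrDl Ay // -mulrA Ax // mulr0 addr0.
have AS n : A n `<=` A n.+1.
  move=> x Ax js; case/lastP: js => // js j; rewrite size_rcons => -[js_n] jsJ.
  rewrite -cats1 big_cat /= mulrA Ax ?mul0r // => i i_js.
  by apply: jsJ; rewrite mem_rcons inE i_js orbT.
have [||_ [n _ <-] maxA] := noethS (P := range A); first by move=> _ [n _ <-].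
  by exists (A 0%N); exists 0%N.
have {}maxA : A n.+1 `<=` A n by apply: maxA => //; exists n.+1.
suff An a : A n a by exists n => js js_n jsJ; rewrite -[LHS]mul1r; exact: An.
apply: contrapT => An_a.
pose ann (a : S) : set S^o := [set x | x * a = 0].
pose P U := exists2 a, ~ A n a & U = ann a.
have [||_ [b An_b ->] maxP] := noethS (P := P).
- move=> _ [b _ ->]; split=> [|c x y xb yb]; rewrite /ann /= ?mul0r //.
  by rewrite mulrDl yb -mulrA xb mulr0 addr0.
- by exists (ann a); exists a.
apply: (An_b); apply: maxA => -[//|j js] [js_n] jsJ.
rewrite big_cons mulrA; have Jj : J j by apply: jsJ; rewrite mem_head.
suff An_bj : A n (b * j).
  by apply: An_bj => // i i_js; apply: jsJ; rewrite inE i_js orbT.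
apply: contrapT => An_bj; have b_n0 : b != 0.
  by apply/eqP => b0; apply: An_b; rewrite b0; exact: (hA n).1.
have [x xb_n0 xbj] := local_ideal_annihilate Jj b_n0.
move/eqP: xb_n0; apply; apply: (maxP (ann (b * j))); first by exists (b * j).
  by move=> y; rewrite /ann /= mulrA => ->; rewrite mul0r.
by rewrite /ann /= mulrA.
Qed.

Lemma local_socle (C : lmodType S) (c : C) : c != 0 ->
  exists2 x : S, x *: c != 0 & forall j : S, J j -> j *: (x *: c) = 0.
Proof.
have [n nilJ] := local_ideal_nilpotent.
have {nilJ} : forall js : seq S, size js = n -> (forall j, j \in js -> J j) ->
    (\prod_(j <- js) j) *: c = 0.
  by move=> js js_n jsJ; rewrite nilJ // scale0r.
elim: n c => [|n IHn] c nil_c c_n0.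
  by move/eqP: c_n0; case; rewrite -[RHS](nil_c [::]) // big_nil scale1r.
have [Jc|] := pselect (forall j : S, J j -> j *: c = 0).
  by exists 1; rewrite scale1r.
move=> /existsNP[j /not_implyP[Jj /eqP jc_n0]].
have [|x xjc Jxjc] := IHn (j *: c) _ jc_n0.
  move=> js js_n jsJ; rewrite scalerA.
  rewrite [_ * j](_ : _ = \prod_(i <- rcons js j) i); last first.
    by rewrite -cats1 big_cat big_seq1.
  apply: nil_c; first by rewrite size_rcons js_n.
  by move=> i; rewrite mem_rcons inE => /predU1P[->|/jsJ].
by exists (x * j); rewrite -scalerA.
Qed.

(** [S] has an element [s] with the same annihilator as [c], so there is a map
    from [S] to [M] that sends [s] to [c]; let [z] be the image of 1. If
    [x *: z] is in [F] and [x] is nonzero, [S x] meets [S s], so that [F]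
    contains a nonzero multiple of [c]. With [F] trivial, this says that [z]
    generates a free module. *)
Lemma free_generator (M : lmodType S) (c : M) :
  injective_module M -> c != 0 -> (forall j : S, J j -> j *: c = 0) ->
  exists z, forall F : set M, submod F ->
    (forall a, F (a *: c) -> a *: c = 0) ->
    forall x : S, F (x *: z) -> x = 0.
Proof.
have [_ J1 invJ] := locJ; move=> injM c_n0 Jc.
have [|s] := @local_socle S^o (1 : S); first exact: oner_neq0.
rewrite [_ *: _]mulr1 => s_n0 Js.
have {}Js (j : S) : J j -> j * s = 0 by exact: Js.
pose G : set (S^o * M) := [set y | exists a : S, y = (a * s, a *: c)].
have [|z zE] := injective_extends_regular (G := G) injM.
  split; last first.
    move=> _ [a [/esym as0 ->]]; apply: Jc; apply: contrapT => /invJ[y ya1].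
    by move/eqP: s_n0; apply; rewrite -[s]mul1r -ya1 -mulrA as0 mulr0.
  split=> [|b _ _ [a ->] [a' ->]]; first by exists 0; rewrite mul0r scale0r.
  by exists (b * a + a'); rewrite mulrDl scalerDl -mulrA -scalerA.
have sz : c = s *: z by apply: zE; exists 1; rewrite mul1r scale1r.
exists z => F hF Fc0 x Fxz; apply: contrapT => /eqP x_n0.
have [a [b [axbs ax_n0]]] := selfinjective_uniform x_n0 s_n0.
have bc : b *: c = (a * x) *: z by rewrite sz scalerA axbs.
have /eqP : b *: c = 0.
  by apply: Fc0; rewrite bc -scalerA; exact: submodZ.
have [Jb|/invJ[y yb1]] := pselect (J b); last first.
  by move/eqP=> bc0; rewrite -[c]scale1r -yb1 -scalerA bc0 scaler0 eqxx in c_n0.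
by rewrite axbs Js // eqxx in ax_n0.
Qed.

(** The ideals of the [r] such that [r *: m] is in a member of the chain form a
    chain, and one of them is the largest. *)
Lemma noetherian_preimage_chain (M : lmodType S) (F : set (set M)) (m : M) :
  (forall X, F X -> submod X) -> total_on F subset -> F !=set0 ->
  exists2 X, F X & forall Y (r : S), F Y -> Y (r *: m) -> X (r *: m).
Proof.
move=> FP totF [X0 FX0].
pose tr (X : set M) : set S^o := [set r : S | X (r *: m)].
have [||_ [X FX <-] maxX] := noethS (P := tr @` F).
- move=> _ [X FX <-]; have hX := FP _ FX.
  split=> [|a r s Xr Xs]; rewrite /tr /= ?scale0r; first exact: hX.1.
  by rewrite scalerDl -scalerA; exact: hX.2.
- by exists (tr X0); exists X0.
exists X => // Y r FY Yr; have [XY|YX] := totF X Y FX FY; last exact: YX.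
by apply: (maxX (tr Y)) => // s; exact: XY.
Qed.

(** The maps to [F] from ideals of [S] that are induced by an element of [M]
    extend to [S]. When [M] is injective this amounts to the injectivity of [F],
    but unlike the latter it is visibly preserved by the unions of chains and
    the adjunctions of free generators below. *)
Definition extends_induced_maps (M : lmodType S) (F : set M) :=
  forall m, exists2 y, F y & forall r : S, F (r *: m) -> r *: m = r *: y.

(** The [z]-component of [r *: m] is a partial map from [S] to itself, hence of
    the form [r |-> r * t]; then [m - t *: z] only involves [F]. *)
Lemma extends_induced_maps_adjoin (M : lmodType S) (F : set M) (z : M) :
  submod F -> extends_induced_maps F -> (forall x : S, F (x *: z) -> x = 0) ->
  extends_induced_maps [set u | exists c : S, F (u - c *: z)].
Proof.
move=> hF extF Fz m.
pose G : set (S^o * S^o) := [set y | F (y.1 *: m - y.2 *: z)].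
have [|t tE] := injective_extends_regular (G := G) selfinj.
  split; last first.
    move=> y; rewrite /G /= scale0r sub0r -scaleNr => /Fz/eqP.
    by rewrite oppr_eq0 => /eqP.
  split=> [|a x y Gx Gy]; rewrite /G /= ?scale0r ?subr0; first exact: hF.1.
  by rewrite !scalerDl -!scalerA opprD addrACA -scalerBr; exact: hF.2.
have [y Fy yE] := extF (m - t *: z).
exists (y + t *: z); first by exists t; rewrite addrK.
move=> r [c Fc]; have ct : c = r * t by exact: tE.
rewrite scalerDr -yE; first by rewrite scalerBr subrK.
by rewrite scalerBr scalerA -ct.
Qed.

(** Zorn's lemma is applied to partial lifts [G] of [f] along [p] whose domain
    satisfies [extends_induced_maps]. If [m] is not in the domain of a maximal
    [G], subtracting from it the element [y] given by that condition leaves an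
    element whose multiples meet the domain trivially. It therefore has a
    multiple killed by [J], which gives a free generator [z] independent of the
    domain, and any preimage of [f z] under [p] extends the lift. *)
Lemma local_selfinjective_projective (M : lmodType S) :
  injective_module M -> projective_module M.
Proof.
move=> injM A B p f surj_p.
pose dom (G : set (M * A)) : set M := [set m | exists a, G (m, a)].
have hdom G : submod G -> submod (dom G).
  move=> hG; split=> [|c x y [a Gx] [b Gy]]; first by exists 0; exact: hG.1.
  by exists (c *: a + b); exact: (hG.2 c _ _ Gx Gy).
pose P G := [/\ functional_graph G, forall m a, G (m, a) -> p a = f m
  & extends_induced_maps (dom G)].
have [||F FP totF [X0 FX0]|G [hG pG extG] maxG] := @Zorn_submod _ _ P [set 0].
- by move=> U [[]].
- split; last 2 first.
  + by move=> m a [-> ->]; rewrite !raddf0.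
  + move=> m; exists 0; first by exists 0.
    by move=> r [a [-> _]]; rewrite scaler0.
  split; last by move=> y [].
  by split=> // c x y -> ->; rewrite scaler0 addr0.
- have FF X : F X -> functional_graph X by move=> /FP[].
  split; first by apply: functional_graph_chain => //; exists X0.
    by move=> m a [X FX]; have [_ pX _] := FP _ FX; exact: pX.
  move=> m; have [|||_ [X FX <-] XE] :=
    @noetherian_preimage_chain M (dom @` F) m.
  + by move=> _ [X /FF[hX _] <-]; exact: hdom.
  + move=> _ _ [X FX <-] [Y FY <-]; have [XY|YX] := totF X Y FX FY.
      by left=> x [a /XY]; exists a.
    by right=> x [a /YX]; exists a.
  + by exists (dom X0); exists X0.
  have [_ _ /(_ m)[y [a Xya] yE]] := FP _ FX.
  exists y; first by exists a; exists X.
  move=> r [b [Y FY Yb]]; apply: yE; apply: (XE (dom Y)); first by exists Y.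
  by exists b.
suff totG m : dom G m.
  have [g Gg] := linear_of_graph hG.1 totG hG.2.
  by exists g => m /=; rewrite (pG m).
apply: contrapT => Gm; have [y Gy yE] := extG m.
have my_n0 : m - y != 0.
  by rewrite subr_eq0; apply/eqP => my; apply: Gm; rewrite my.
have [x xmy_n0 Jxmy] := local_socle my_n0.
have [z zE] := free_generator injM xmy_n0 Jxmy.
have {zE} Gz (r : S) : dom G (r *: z) -> r = 0.
  apply: zE; first exact: hdom hG.1.
  move=> a; rewrite scalerA scalerBr => Gmy; apply/eqP.
  rewrite subr_eq0; apply/eqP/yE; rewrite -[X in dom G X](subrK ((a * x) *: y)).
  apply: submodD => //; first exact: hdom hG.1.
  by apply: submodZ => //; exact: hdom hG.1.
have [a0 pa0] := surj_p (f z).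
pose G' : set (M * A) := [set u | exists c : S, G (u - c *: (z, a0))].
have GG' : G `<=` G' by move=> u Gu; exists 0; rewrite scale0r subr0.
have G'z : G' (z, a0) by exists 1; rewrite scale1r subrr; exact: hG.1.1.
have Gz' : G (z, a0).
  apply: (maxG G') => //; split.
  - split; first exact/adjoin_submod/hG.1.
    move=> b [c]; rewrite (_ : _ - _ = (- c *: z, b - c *: a0)); last first.
      by congr pair; rewrite /= sub0r scaleNr.
    move=> Gcb; have c0 : c = 0.
      by apply/eqP; rewrite -oppr_eq0; apply/eqP/Gz; exists (b - c *: a0).
    by move: Gcb; rewrite c0 oppr0 !scale0r subr0; exact: hG.2.
  - move=> n b [c /pG /=]; rewrite (linearB p) (linearB f) !linearZ /= pa0.
    by move/addIr.
  suff -> : dom G' = [set u | exists c : S, dom G (u - c *: z)].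
    exact: (extends_induced_maps_adjoin (hdom _ hG.1)).
  apply/seteqP; split=> u.
    by move=> [b [c Gub]]; exists c; exists (b - c *: a0).
  move=> [c [b Gub]]; exists (b + c *: a0); exists c.
  by rewrite (_ : _ - _ = (u - c *: z, b)) //; congr pair; rewrite /= addrK.
have : (1 : S) = 0 by apply: Gz; exists a0; rewrite scale1r.
by move/eqP; rewrite oner_eq0.
Qed.

End LocalRing.

(** * Max-projectivity of the injective hull *)

(** If [E = S + L] with [L] proper, the elements of [S] that lie in [L] form a
    proper ideal, hence are in [J]; so the class modulo [J] of the component in
    [S] is well-defined. *)
Lemma not_superfluous_map (S : nzRingType) (E : lmodType S)
    (J : submodClosed S^o) (e : {linear S^o -> E}) :
  local_ideal [set x | x \in J] -> ~ superfluous (image_submod e) ->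
  exists f : {linear E -> quotient_module J},
    f (e (1 : S)) = quotient_pi J (1 : S).
Proof.
move=> [hJ J1 invJ] /existsNP[L /not_implyP[[x0 x0L] /contrapT sumL]].
have hL := submod_mem L.
have L_J (r : S) : e r \in L -> r \in J.
  move=> erL; apply: contrapT => /invJ[y yr1]; case/negP: x0L.
  have [_ [l [/asboolP[s <-] lL ->]]] := sumL x0.
  apply: (submodD hL _ lL); have -> : e s = ((s : S) * y) *: e r.
    have syr : ((s : S) * y) * r = s by rewrite -mulrA yr1 mulr1.
    by rewrite -linearZ /=; congr (e _); rewrite -[LHS]syr.
  exact: (submodZ _ hL erL).
pose G : set (E * quotient_module J) :=
  [set z | exists2 r : S, z.1 - e r \in L & z.2 = quotient_pi J r].
have [||y|f fG] := @linear_of_graph _ _ _ G.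
- split=> [|a x y [r xr rE] [s ys sE]].
    exists 0; last by rewrite (raddf0 (quotient_pi J)).
    by rewrite /= raddf0 subr0; exact: hL.1.
  exists (a * r + s : S^o); last first.
    by rewrite /= rE sE [RHS](linearP (quotient_pi J)).
  by rewrite /= [e _](linearP e) opprD addrACA -scalerBr; exact: hL.2.
- move=> x; have [_ [l [/asboolP[r <-] lL ->]]] := sumL x.
  by exists (quotient_pi J r); exists r; rewrite //= addrC addKr.
- move=> [r /= + ->]; rewrite sub0r => /(submodN hL); rewrite opprK => /L_J rJ.
  by rewrite -(raddf0 (quotient_pi J)); apply/quotient_piE; rewrite subr0.
exists f; have [r /= erL ->] := fG (e (1 : S)).
apply/quotient_piE; rewrite -opprB; apply: (submodN hJ); apply: L_J.
by rewrite raddfB.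
Qed.

Lemma max_QF_small_or_selfinjective (R : nzRingType) :
  right_noetherian R -> local_ring R -> right_max_QF R ->
  right_small R \/ injective_module (regular_rmod R).
Proof.
move=> /noetherian_max noethR [J maxJ uniqJ] maxQF.
have locJ := local_ideal_max noethR maxJ uniqJ; have [hJ J1 invJ] := locJ.
have [E0 injE0 [e0 inj_e0]] := enough_injectives_regular R^c.
have [E [e hullE]] := injective_hull_exists injE0 inj_e0.
have [inj_e injE _] := hullE.
have [small|not_small] := pselect (superfluous (image_submod e)).
  by left; exists E, e.
right; have [f f1] := not_superfluous_map locJ not_small.
have [g fE] := maxQF E injE J maxJ f.
have [|y yg1] := invJ (g (e (1 : R^c))).
  move=> gJ; apply: J1.
  have /quotient_piE pi1 :
      quotient_pi J (1 : R^c) = quotient_pi J (g (e (1 : R^c))).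
    by rewrite -f1 fE.
  by rewrite -[1](subrK (g (e (1 : R^c)))); exact: (submodD hJ pi1 gJ).
(* [g] maps [x0] to 1, so the map sending 1 to [x0] is a section of [g]. *)
pose x0 := y *: e (1 : R^c).
have x0_lin : linear (fun r : regular_rmod R => (r : R^c) *: x0).
  by move=> a r s; rewrite scalerDl -scalerA.
pose e' : {linear regular_rmod R -> E} := HB.pack
  (fun r : regular_rmod R => (r : R^c) *: x0)
  (GRing.isLinear.Build R^c (regular_rmod R) E *:%R _ x0_lin).
apply: (injective_retract (e := e') (r := g) injE) => r.
by rewrite /= !linearZ /= [y *: _]yg1 [_ *: _]mulr1.
Qed.

Theorem corollary9 (R : nzRingType)
    (noethR : right_noetherian R) (localR : local_ring R) :
  (right_almost_QF R <-> right_max_QF R) /\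
  (right_max_QF R <-> (QF R \/ right_small R)).
Proof.
have almost_max : right_almost_QF R -> right_max_QF R.
  by move=> almostQF M injM I _; exact: almostQF.
have max_cases : right_max_QF R -> QF R \/ right_small R.
  move=> /(max_QF_small_or_selfinjective noethR localR)[|selfinj].
    by right.
  left; have [J maxJ uniqJ] := localR; have noethS := noetherian_max noethR.
  have locJ := local_ideal_max noethS maxJ uniqJ.
  exact: local_selfinjective_projective locJ selfinj noethS.
have cases_almost : QF R \/ right_small R -> right_almost_QF R.
  move=> [qfR M /qfR projM I f|[E [e [[inj_e _ _] small_e]]] M injM I f].
    exact: projM f (quotient_pi_surj (U := I)).
  exists \0 => m; rewrite /= raddf0.
  exact: superfluous_hom0 (noetherian_max noethR) inj_e small_e injM m.
by split; split; auto.
Qed.
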